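(* Let $k$ be a field, $L_n=k[z_1^{\pm1},\dots,z_n^{\pm1}]$ the Laurent polynomial algebra, $\sigma$ a $k$-algebra automorphism of $L_n$, $a\in L_n$, and $A=L_n(\sigma,a)$ the generalized Weyl algebra. Write $\sigma(z_i)=\alpha_iz_1^{a_{1i}}z_2^{a_{2i}}\cdots z_n^{a_{ni}}$ with $\alpha_i\in k^*$, $a_{ji}\in\mathbb{Z}$, and let $M_\sigma=(a_{ij})\in\mathbb{Z}^{n\times n}$. Then the following are equivalent: (a) $\operatorname{GKdim}(A)=n+1$; (b) $\sigma$ is locally algebraic; (c) $M_\sigma$ has finite order, i.e. $M_\sigma^m$ is the identity matrix for some $m\geq 1$; (d) $M_\sigma$ is power-bounded, i.e. there is $N>0$ such that the absolute values of all entries of $M_\sigma^m$ are less than $N$ for all $m\geq1$.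
   Context: Every automorphism of $L_n$ maps each $z_i$ to a unit, hence has the displayed form. For an algebra $D$, an automorphism $\sigma$ and a central $a\in D$, the generalized Weyl algebra $D(\sigma,a)$ is generated by $D$ and indeterminates $x,y$ subject to $xd=\sigma(d)x$, $yd=\sigma^{-1}(d)y$ ($d\in D$), $yx=a$, $xy=\sigma(a)$. $\operatorname{GKdim}(B)=\sup_V\limsup_{n\to\infty}\log_n\dim_k(\sum_{i=0}^nV^i)$ over finite-dimensional subspaces $V$. An automorphism $\sigma$ of $D$ is locally algebraic if every finite-dimensional subspace of $D$ lies in a finite-dimensional subspace $U$ with $\sigma(U)=U$. *)

(* Defs.v *)
From HB Require Import structures.
From mathcomp Require Import all_boot all_order all_algebra.
From mathcomp Require Import boolp classical_sets reals ereal exp sequences Rstruct.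
Set Implicit Arguments.
Unset Strict Implicit.
Unset Printing Implicit Defensive.
Import Order.TTheory GRing.Theory Num.Theory.
Local Open Scope ring_scope.

Definition lin_indep (K : fieldType) (V : lmodType K) (s : seq V) : Prop :=
  forall c : 'I_(size s) -> K,
    \sum_(i < size s) c i *: s`_i = 0 -> forall i, c i = 0.

Definition in_span (K : fieldType) (V : lmodType K) (s : seq V) (v : V) : Prop :=
  exists c : 'I_(size s) -> K, v = \sum_(i < size s) c i *: s`_i.

Definition dim_span (K : fieldType) (V : lmodType K) (s : seq V) : nat :=
  \max_(b : (size s).-tuple bool | `[< lin_indep (mask b s) >]) count id b.

Definition words_len (K : fieldType) (B : algType K) (s : seq B) (i : nat) : seq B :=
  [seq \prod_(j < i) s`_(f j) | f : {ffun 'I_i -> 'I_(size s)} <- enum {ffun 'I_i -> 'I_(size s)}].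

(* a spanning family of  V^0 + V^1 + ... + V^m  where V = span s *)
Definition words_upto (K : fieldType) (B : algType K) (s : seq B) (m : nat) : seq B :=
  flatten [seq words_len s i | i <- iota 0 m.+1].

(* GKdim(B) = sup_V limsup_m log_m dim (sum_{i<=m} V^i), V ranging over the
   finite-dimensional subspaces (every one is the span of a finite family s). *)
Definition GKdim (K : fieldType) (B : algType K) : \bar Rdefinitions.R :=
  ereal_sup [set limn_esup (fun m : nat =>
       ((ln ((dim_span (words_upto s m))%:R : Rdefinitions.R)
          / ln (m%:R : Rdefinitions.R))%:E)) | s in [set: seq B]].

Definition lmono (K : fieldType) (L : comUnitAlgType K) (n : nat) (z : 'I_n -> L)
  (u : 'cV[int]_n) : L := \prod_(j < n) z j ^ u j 0.

Definition is_laurent_alg (K : fieldType) (L : comUnitAlgType K) (n : nat)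
  (z : 'I_n -> L) : Prop :=
  (forall i, z i \is a GRing.unit) /\
  (forall f : L, exists (us : seq 'cV[int]_n) (c : 'I_(size us) -> K),
       f = \sum_(i < size us) c i *: lmono z us`_i) /\
  (forall us : seq 'cV[int]_n, uniq us -> lin_indep [seq lmono z u | u <- us]).

Definition gwa_rel (K : fieldType) (D : comUnitAlgType K)
  (sigma sigmainv : D -> D) (a : D) (B : algType K) (iota : D -> B) (x y : B) : Prop :=
  (forall d, x * iota d = iota (sigma d) * x) /\
  (forall d, y * iota d = iota (sigmainv d) * y) /\
  y * x = iota a /\ x * y = iota (sigma a).

(* (A, iota, x, y) is the generalized Weyl algebra D(sigma, a): the K-algebra
   generated by D and x, y subject to the relations above, i.e. the universal
   (initial) such K-algebra. *)
Definition is_gwa (K : fieldType) (D : comUnitAlgType K)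
  (sigma sigmainv : D -> D) (a : D) (A : algType K) (iota : {lrmorphism D -> A})
  (x y : A) : Prop :=
  gwa_rel sigma sigmainv a iota x y /\
  forall (B : algType K) (iota' : {lrmorphism D -> B}) (x' y' : B),
    gwa_rel sigma sigmainv a iota' x' y' ->
    exists f : {lrmorphism A -> B},
      ((forall d, f (iota d) = iota' d) /\ f x = x' /\ f y = y') /\
      forall g : {lrmorphism A -> B},
        (forall d, g (iota d) = iota' d) -> g x = x' -> g y = y' ->
        forall v, g v = f v.

Definition locally_algebraic (K : fieldType) (D : lmodType K) (sigma : D -> D) : Prop :=
  forall s : seq D, exists t : seq D,
    (forall v, v \in s -> in_span t v) /\
    (forall u, in_span t u -> in_span t (sigma u)) /\
    (forall u, in_span t u -> exists w, in_span t w /\ sigma w = u).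

(* Main.v *)
Require Import Defs.
From HB Require Import structures.
From mathcomp Require Import all_boot all_order all_algebra.
From mathcomp Require Import boolp classical_sets reals ereal exp sequences Rstruct.
From mathcomp Require Import topology ereal_normedtype.
From mathcomp Require Import zify lra ring.
Set Implicit Arguments.
Unset Strict Implicit.
Unset Printing Implicit Defensive.
Import Order.TTheory GRing.Theory Num.Theory Defs.
Local Open Scope ring_scope.

(** Since [sigma] sends [z^u] to a scalar multiple of [z^(M u)], and [M] is
    injective, pigeonhole on integer matrices shows that power-bounded means
    finite order, and both mean that the exponents occurring in [sigma]-orbits
    stay in a finite set, i.e. that [sigma] is locally algebraic.

    Upper bound on the growth of [A]: when [M] is power-bounded, the size of an
    exponent [u] can be measured by the supremum over its [M]-orbit, which
    [sigma] and its inverse do not increase; the spans of the monomials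
    [z^u x^j], [z^u y^j] of bounded weight then form a filtration of dimension
    [O(N^(n+1))] for which every element of [A] acts with finite degree.

    Lower bound: the monomials [z^u x^j] are independent, because [A] acts on
    sequences [int -> L] through the skew Laurent ring ([x] is the shift,
    [y = a x^-1]).  The words [z^u x^i z^w x^(j-i)] yield the exponents
    [u + M^i w].  If [M] has infinite order, its powers are distinct, so one of
    the first [m] powers has an entry at least of order [m^(1/n^2)]; translating
    a box of side [m] by multiples of the corresponding column gives at least
    [c m^(n+1+1/n^2)] independent words of length [O(m)]. *)

(** * Independence, spans and words *)

Section LinearAlgebra.
Variables (K : fieldType) (V : lmodType K).
Implicit Types (s t : seq V) (v : V).

Lemma lin_indep_uniq s : lin_indep s -> uniq s.
Proof.
move=> Hs; apply/(uniqP 0) => i j.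
rewrite !inE => Hi Hj Hij; apply/eqP; apply: contraT => ne.
pose c (l : 'I_(size s)) : K := (l == i :> nat)%:R - (l == j :> nat)%:R.
suff /Hs /(_ (Ordinal Hi)) /eqP : \sum_(l < size s) c l *: s`_l = 0.
  by rewrite /c /= eqxx (negbTE ne) subr0 oner_eq0.
under eq_bigr do rewrite scalerBl.
rewrite sumrB (bigD1 (Ordinal Hi)) //= eqxx scale1r big1 => [|l Hl]; last first.
  by move: Hl; rewrite -val_eqE /= => /negbTE ->; rewrite scale0r.
rewrite (bigD1 (Ordinal Hj)) //= eqxx scale1r big1 => [|l Hl]; last first.
  by move: Hl; rewrite -val_eqE /= => /negbTE ->; rewrite scale0r.
by rewrite !addr0 Hij subrr.
Qed.

(** Coefficients indexed by vectors instead of positions, so that families can be filtered and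
    reordered inside big operators. *)
Lemma lin_indepP s : uniq s ->
  (lin_indep s <-> forall c : V -> K, \sum_(v <- s) c v *: v = 0 ->
     forall v, v \in s -> c v = 0).
Proof.
move=> us; split=> H c.
  rewrite (big_nth 0) big_mkord => Hc v vs.
  have Hi : (index v s < size s)%N by rewrite index_mem.
  have := H (fun i => c s`_i) Hc (Ordinal Hi).
  by rewrite /= nth_index.
move=> Hc i.
(* The default 0 concerns only vectors outside [s]. *)
pose d v := if insub (index v s) is Some i then c i else 0.
have dE (j : 'I_(size s)) : d s`_j = c j.
  by rewrite /d index_uniq // valK.
rewrite -dE; apply: H; last exact: mem_nth.
rewrite (big_nth 0) big_mkord -[RHS]Hc.
by apply: eq_bigr => j _; rewrite dE.
Qed.

Lemma lin_indep_map (I : eqType) (r : seq I) (F : I -> V) : uniq r ->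
  (forall c : I -> K, \sum_(i <- r) c i *: F i = 0 ->
     forall i, i \in r -> c i = 0) -> lin_indep (map F r).
Proof.
move=> ur H c Hc j.
have jr : (j < size r)%N by case: (j) => j' /=; rewrite size_map.
have [i0 _] : exists i, i \in r.
  have : (0 < size r)%N by exact: leq_ltn_trans jr.
  by case: (r) => // i r' _; exists i; rewrite mem_head.
pose d i := if insub (index i r) is Some l then c l else 0.
have dE (l : 'I_(size (map F r))) : d (nth i0 r l) = c l.
  by rewrite /d index_uniq ?valK // -(size_map F).
rewrite -dE; apply: H; last exact: mem_nth.
rewrite (big_nth i0) -(size_map F) big_mkord -[RHS]Hc.
by apply: eq_bigr => l _; rewrite dE (nth_map i0) // -(size_map F).
Qed.

Lemma lin_indep_sub s t : uniq t -> {subset t <= s} -> lin_indep s ->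
  lin_indep t.
Proof.
move=> ut ts Hs; have us := lin_indep_uniq Hs.
apply/(lin_indepP ut) => c Hc v vt.
have /(_ (fun v => if v \in t then c v else 0)) := (lin_indepP us).1 Hs.
move=> /(_ _ v (ts _ vt)); rewrite vt; apply.
under eq_bigr => u _ do rewrite (fun_if (fun c => c *: u)) scale0r.
rewrite -big_mkcond -big_filter -[RHS]Hc.
apply/perm_big/uniq_perm => // [|u]; first exact: filter_uniq.
by rewrite mem_filter; case: (boolP (u \in t)) => //= /ts ->.
Qed.

Lemma dim_span_ge s t : lin_indep t -> {subset t <= s} ->
  (size t <= dim_span s)%N.
Proof.
move=> Ht ts.
have ut := lin_indep_uniq Ht.
(* [dim_span] ranges over subsequences of [s], so [t] is first put in the order of [s], each vector
   being kept once. *)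
have : subseq [seq v <- undup s | v \in t] s.
  exact: subseq_trans (filter_subseq _ _) (undup_subseq _).
case/subseqP=> b sb Eb.
have pt : perm_eq t (mask b s).
  rewrite -Eb; apply: uniq_perm => // [|u].
    by rewrite filter_uniq ?undup_uniq.
  by rewrite mem_filter mem_undup; case: (boolP (u \in t)) => //= /ts ->.
rewrite (perm_size pt) size_mask //.
pose b' : (size s).-tuple bool := Tuple (introT eqP sb).
rewrite (_ : count id b = count id b') //.
apply: (@leq_bigmax_cond _ _ (fun b : (size s).-tuple bool => count id b)).
apply/asboolP; apply: (@lin_indep_sub t) => //=.
  by rewrite -(perm_uniq pt).
by move=> u; rewrite (perm_mem pt).
Qed.

(** Steinitz bound: were [s] longer than [t], the matrix writing [s] over [t] would have more rows
    than columns, and a nonzero vector of its left kernel would be a relation in [s]. *)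
Lemma lin_indep_size_le s t : lin_indep s -> (forall v, v \in s -> in_span t v) ->
  (size s <= size t)%N.
Proof.
move=> Hs Hst; rewrite leqNgt; apply/negP => lt.
have /choice[c Hc] : forall i : 'I_(size s), exists c : 'I_(size t) -> K,
    s`_i = \sum_(j < size t) c j *: t`_j.
  by move=> i; apply: Hst; exact: mem_nth.
pose C := \matrix_(i < size s, j < size t) c i j.
have : kermx C != 0.
  rewrite -mxrank_eq0 mxrank_ker subn_eq0 -ltnNge.
  exact: leq_ltn_trans (rank_leq_col C) lt.
case/rowV0Pn=> w /sub_kermxP wC /eqP; apply; apply/rowP => i; rewrite mxE.
apply: (Hs (fun i => w 0 i)).
under eq_bigr => j _ do rewrite Hc scaler_sumr.
rewrite exchange_big big1 // => j _.
under eq_bigr => l _ do rewrite scalerA.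
rewrite -scaler_suml; have /rowP/(_ j) := wC; rewrite !mxE => E.
have -> : \sum_(l < size s) w 0 l * c l j = 0.
  by rewrite -[RHS]E; apply: eq_bigr => l _; rewrite mxE.
by rewrite scale0r.
Qed.

Lemma dim_span_le s t : (forall v, v \in s -> in_span t v) ->
  (dim_span s <= size t)%N.
Proof.
move=> Hst; apply/bigmax_leqP => b /asboolP Hb.
rewrite -(@size_mask _ b s) ?size_tuple //; apply: lin_indep_size_le => // v vb.
exact/Hst/(mem_mask vb).
Qed.

Lemma in_span0 s : in_span s 0.
Proof. by exists (fun=> 0); rewrite big1 // => i _; rewrite scale0r. Qed.

Lemma in_spanD s u v : in_span s u -> in_span s v -> in_span s (u + v).
Proof.
case=> c -> [d ->]; exists (fun i => c i + d i).
by rewrite -big_split; apply: eq_bigr => i _; rewrite scalerDl.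
Qed.

Lemma in_spanZ s a v : in_span s v -> in_span s (a *: v).
Proof.
case=> c ->; exists (fun i => a * c i).
by rewrite scaler_sumr; apply: eq_bigr => i _; rewrite scalerA.
Qed.

Lemma in_span_sum (I : Type) (r : seq I) (P : pred I) (F : I -> V) s :
  (forall i, P i -> in_span s (F i)) -> in_span s (\sum_(i <- r | P i) F i).
Proof. by move=> H; elim/big_ind: _ => //; [exact: in_span0|exact: in_spanD]. Qed.

Lemma in_span_mem s v : v \in s -> in_span s v.
Proof.
move=> vs; have Hi : (index v s < size s)%N by rewrite index_mem.
exists (fun j => (j == Ordinal Hi)%:R).
rewrite (bigD1 (Ordinal Hi)) //= eqxx scale1r nth_index // big1 ?addr0 // => j.
by move=> /negbTE ->; rewrite scale0r.
Qed.

End LinearAlgebra.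

Lemma in_span_linear (K : fieldType) (U V : lmodType K) (f : {linear U -> V})
    (s : seq U) (t : seq V) :
  (forall v, v \in s -> in_span t (f v)) ->
  forall v, in_span s v -> in_span t (f v).
Proof.
move=> H v [c ->]; rewrite linear_sum; apply: in_span_sum => i _.
by rewrite linearZ; apply/in_spanZ/H/mem_nth.
Qed.

Lemma in_span_trans (K : fieldType) (V : lmodType K) (s t : seq V) :
  (forall v, v \in s -> in_span t v) -> forall v, in_span s v -> in_span t v.
Proof. exact: (@in_span_linear K V V idfun). Qed.

(** Lists replace finite functions as indices, which turns the product of two words into
    concatenation. *)
Lemma words_uptoP (K : fieldType) (B : algType K) (s : seq B) (m : nat) (w : B) :
  w \in words_upto s m <->
  exists l : seq B, [/\ {subset l <= s}, (size l <= m)%N & w = \prod_(v <- l) v].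
Proof.
split.
  case/flattenP=> r /mapP[i]; rewrite mem_iota add0n ltnS => /andP[_ im] ->.
  case/mapP=> f _ ->; exists [seq s`_(f j) | j <- enum 'I_i]; split.
  - by move=> v /mapP[j _ ->]; exact: mem_nth.
  - by rewrite size_map size_enum_ord.
  - by rewrite big_map enumT [index_enum _]unlock.
case=> l [ls lm ->]; apply/flattenP; exists (words_len s (size l)).
  by apply/mapP; exists (size l) => //; rewrite mem_iota add0n ltnS lm.
apply/mapP.
have Hs (j : 'I_(size l)) : (index (nth 0%R l j) s < size s)%N.
  by rewrite index_mem; apply/ls/mem_nth.
exists [ffun j => Ordinal (Hs j)]; first by rewrite mem_enum.
rewrite (big_nth 0) big_mkord; apply: eq_bigr => j _.
by rewrite ffunE /= nth_index //; apply/ls/mem_nth.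
Qed.

Section Words.
Variables (K : fieldType) (B : algType K) (s : seq B).

Lemma words_upto_mono m m' w : (m <= m')%N -> w \in words_upto s m ->
  w \in words_upto s m'.
Proof.
move=> mm /words_uptoP[l [ls lm ->]]; apply/words_uptoP.
by exists l; split=> //; exact: leq_trans mm.
Qed.

Lemma words_upto1 m : 1 \in words_upto s m.
Proof. by apply/words_uptoP; exists [::]; rewrite big_nil. Qed.

Lemma words_upto_gen w : w \in s -> w \in words_upto s 1.
Proof.
move=> ws; apply/words_uptoP; exists [:: w]; rewrite big_seq1; split=> //.
by move=> v; rewrite inE => /eqP ->.
Qed.

Lemma words_uptoM m m' w w' : w \in words_upto s m -> w' \in words_upto s m' ->
  w * w' \in words_upto s (m + m').
Proof.
move=> /words_uptoP[l [ls lm ->]] /words_uptoP[l' [ls' lm' ->]].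
apply/words_uptoP; exists (l ++ l'); rewrite big_cat size_cat leq_add //.
by split=> // v; rewrite mem_cat => /orP[/ls|/ls'].
Qed.

Lemma words_uptoX w j : w \in s -> w ^+ j \in words_upto s j.
Proof.
move=> ws; elim: j => [|j IH]; first exact: words_upto1.
by rewrite exprS -add1n; apply: words_uptoM IH; exact: words_upto_gen.
Qed.

End Words.

(** * Growth exponents as upper limits of logarithmic quotients *)

Section LogGrowth.
Variable R : realType.
Implicit Type d : nat -> nat.

Definition log_growth d : nat -> \bar R :=
  fun m => (ln ((d m)%:R : R) / ln (m%:R : R))%:E.

Lemma ln_nat_large (b : R) : exists N : nat, forall m : nat, (N <= m)%N ->
  (1 < m)%N /\ b < ln (m%:R : R).
Proof.
exists (Num.bound (expR b)).+2 => m Hm; split; first exact: leq_trans Hm.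
rewrite -ltr_expR lnK ?posrE ?ltr0n; last exact: leq_trans Hm.
apply: lt_le_trans (archi_boundP (expR_ge0 b)) _.
by rewrite ler_nat; do 2 apply: ltnW.
Qed.

Lemma ln_nat_ge0 (m : nat) : 0 <= ln (m%:R : R).
Proof. by case: m => [|m]; [rewrite ln0|rewrite ln_ge0 // ler1n]. Qed.

Lemma ln_nat_le (m l : nat) : (m <= l)%N -> ln (m%:R : R) <= ln (l%:R : R).
Proof.
case: m => [|m] Hml; first by rewrite ln0 // ln_nat_ge0.
by rewrite ler_ln ?posrE ?ltr0n ?ler_nat //; exact: leq_trans Hml.
Qed.

Lemma ln_natM (m l : nat) : (0 < m)%N -> (0 < l)%N ->
  ln ((m * l)%:R : R) = ln m%:R + ln l%:R.
Proof. by move=> m0 l0; rewrite natrM lnM ?posrE ?ltr0n. Qed.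

Lemma ln_natX (m p : nat) : (0 < m)%N -> ln ((m ^ p)%:R : R) = p%:R * ln m%:R.
Proof. by move=> m0; rewrite natrX lnXn ?ltr0n // mulr_natl. Qed.

(** After taking logarithms the constant contributes [ln K.+1 / ln m], which is below any [e > 0]
    for large [m]; the successor keeps the logarithm meaningful when [K = 0]. *)
Lemma limn_esup_log_growth_le d (K p : nat) :
  (forall m, (0 < m)%N -> (d m <= K * m ^ p)%N) ->
  (limn_esup (log_growth d) <= p%:R%:E)%E.
Proof.
move=> Hd; apply/lee_addgt0Pr => e e0.
have [N HN] := ln_nat_large (ln K.+1%:R / e).
apply: (@le_trans _ _ (ereal_sup (log_growth d @` [set m | (N <= m)%N])%classic)).
  apply: ereal_inf_lbound; exists [set m | (N <= m)%N]%classic => //.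
  by exists N.
apply: ge_ereal_sup => _ [m /= /HN[m1 Hm] <-].
rewrite -EFinD lee_fin ler_pdivrMr ?ln_gt0 ?ltr1n //.
have m0 : (0 < m)%N by exact: ltnW.
have H1 : ln ((d m)%:R : R) <= ln (K.+1%:R : R) + p%:R * ln (m%:R : R).
  rewrite -ln_natX // -ln_natM ?expn_gt0 ?m0 //; apply: ln_nat_le.
  by apply: leq_trans (Hd _ m0) _; rewrite leq_mul2r leqnSn orbT.
move: Hm; rewrite ltr_pdivrMr // => Hm; lra.
Qed.

(** An upper limit only needs the estimate for arbitrarily large [m]. Raising [d] to the power [q]
    expresses the exponent [p/q] within the natural numbers, and [C] and [K] vanish in the limit. *)
Lemma limn_esup_log_growth_ge d (C K p q : nat) : (0 < K)%N -> (0 < q)%N ->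
  (forall N, exists m, (N <= m)%N /\ (m ^ p <= C * d (K * m) ^ q)%N) ->
  ((p%:R / q%:R)%:E <= limn_esup (log_growth d))%E.
Proof.
move=> K0 q0 Hd; apply/lee_subgt0Pr => e e0.
apply: le_ereal_inf_tmp => _ [V [N _ HN] <-].
(* Beyond this threshold [p ln K + ln C < q e ln (K m)], exactly the loss caused by the two
   constants. *)
have [N1 HN1] := ln_nat_large ((p%:R * ln K%:R + ln C%:R) / (q%:R * e)).
have [m [Hm Hmd]] := Hd (maxn N N1).
apply: le_ereal_sup_tmp.
exists (log_growth d (K * m)).
  exists (K * m)%N => //; apply: HN => /=.
  exact: leq_trans (leq_trans (leq_maxl _ _) Hm) (leq_pmull _ K0).
have [|m1 HM] := HN1 (K * m)%N.
  exact: leq_trans (leq_trans (leq_maxr _ _) Hm) (leq_pmull _ K0).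
rewrite -EFinB lee_fin.
have m0 : (0 < m)%N by case: (m) m1; rewrite ?muln0.
have q0' : (0 : R) < q%:R by rewrite ltr0n.
rewrite ler_pdivlMr ?ln_gt0 ?ltr1n // -subr_ge0.
rewrite ltr_pdivrMr ?mulr_gt0 // in HM.
rewrite -(pmulr_rge0 _ q0').
have [C0 d0] : (0 < C)%N /\ (0 < d (K * m)%N)%N.
  have : (0 < m ^ p)%N by rewrite expn_gt0 m0.
  by move/leq_trans/(_ Hmd); rewrite muln_gt0 expn_gt0 (gtn_eqF q0) orbF => /andP[].
have := ln_nat_le Hmd; rewrite ln_natM ?expn_gt0 ?d0 // !ln_natX //.
move: HM; rewrite ln_natM //.
have -> : q%:R * (ln (d (K * m)%N)%:R - (p%:R / q%:R - e) * (ln K%:R + ln m%:R)) =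
  q%:R * ln (d (K * m)%N)%:R - p%:R * (ln K%:R + ln m%:R)
     + (ln K%:R + ln m%:R) * (q%:R * e) :> R by field; rewrite gt_eqF.
by lra.
Qed.

End LogGrowth.

(** * The action of a generalized Weyl algebra on sequences *)

Section LinearEndomorphisms.
Variables (K : fieldType) (L : algType K).
Local Notation V := (int -> L).

(** The [K]-linear endomorphisms of the space of two-sided sequences, made into an algebra below to
    serve as the target of a representation of the generalized Weyl algebra. *)
Record seq_end := SeqEnd {seq_end_fun :> V -> V;
  seq_endP : forall (c : K) (u v : V),
    seq_end_fun (fun i => c *: u i + v i) =
    (fun i => c *: seq_end_fun u i + seq_end_fun v i)}.

Implicit Types f g h : seq_end.

Lemma seq_end_ext (f g : seq_end) : (forall v i, f v i = g v i) -> f = g.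
Proof.
case: f g => f Hf [g Hg] /= fg.
have E : f = g by apply/funext => v; apply/funext.
by case: _ / E in Hg *; congr SeqEnd; exact: Prop_irrelevance.
Qed.

HB.instance Definition _ := gen_eqMixin seq_end.
HB.instance Definition _ := gen_choiceMixin seq_end.

Lemma seq_end0_subproof (c : K) (u v : V) :
  (fun=> 0) = (fun i : int => c *: (0 : L) + 0).
Proof. by apply/funext => i; rewrite scaler0 addr0. Qed.
Definition seq_end0 := @SeqEnd (fun=> fun=> 0) seq_end0_subproof.

Lemma seq_endD_subproof (f g : seq_end) (c : K) (u v : V) :
  (fun i => f (fun i => c *: u i + v i) i + g (fun i => c *: u i + v i) i) =
  (fun i => c *: (f u i + g u i) + (f v i + g v i)).
Proof. by apply/funext => i; rewrite !seq_endP scalerDr addrACA. Qed.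
Definition seq_endD f g :=
  @SeqEnd (fun v i => f v i + g v i) (seq_endD_subproof f g).

Lemma seq_endN_subproof (f : seq_end) (c : K) (u v : V) :
  (fun i => - f (fun i => c *: u i + v i) i) =
  (fun i => c *: (- f u i) + (- f v i)).
Proof. by apply/funext => i; rewrite !seq_endP scalerN opprD. Qed.
Definition seq_endN f := @SeqEnd (fun v i => - f v i) (seq_endN_subproof f).

Lemma seq_endZ_subproof (a : K) (f : seq_end) (c : K) (u v : V) :
  (fun i => a *: f (fun i => c *: u i + v i) i) =
  (fun i => c *: (a *: f u i) + (a *: f v i)).
Proof.
by apply/funext => i; rewrite !seq_endP scalerDr !scalerA [a * c]mulrC.
Qed.
Definition seq_endZ a f := @SeqEnd (fun v i => a *: f v i) (seq_endZ_subproof a f).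

Definition seq_end1 := @SeqEnd id (fun _ _ _ => erefl).

Lemma seq_endM_subproof (f g : seq_end) (c : K) (u v : V) :
  f (g (fun i => c *: u i + v i)) =
  (fun i => c *: f (g u) i + f (g v) i).
Proof. by rewrite !seq_endP. Qed.
Definition seq_endM f g := @SeqEnd (fun v => f (g v)) (seq_endM_subproof f g).

Lemma seq_endDE (f : seq_end) u v i : f (fun i => u i + v i) i = f u i + f v i.
Proof.
have /(congr1 (fun w => w i)) := seq_endP f 1 u v; rewrite scale1r => <-.
by congr (seq_end_fun f _ i); apply/funext => j; rewrite scale1r.
Qed.

Lemma seq_endZE (f : seq_end) c u i : f (fun i => c *: u i) i = c *: f u i.
Proof.
(* Linearity with scalar -1 at the zero sequence gives [f 0 = - f 0 + f 0 = 0]. *)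
have /(congr1 (fun w => w i)) := seq_endP f (-1) (fun=> 0) (fun=> 0).
have -> : (fun=> -1 *: 0 + 0) = (fun=> 0) :> V.
  by apply/funext => j; rewrite scaler0 addr0.
rewrite scaleN1r addNr => f0.
have /(congr1 (fun w => w i)) := seq_endP f c u (fun=> 0).
rewrite f0 addr0 => <-.
by congr (seq_end_fun f _ i); apply/funext => j; rewrite addr0.
Qed.

Lemma seq_endDA : associative seq_endD.
Proof. by move=> f g h; apply: seq_end_ext => v i /=; rewrite addrA. Qed.
Lemma seq_endDC : commutative seq_endD.
Proof. by move=> f g; apply: seq_end_ext => v i /=; rewrite addrC. Qed.
Lemma seq_end0D : left_id seq_end0 seq_endD.
Proof. by move=> f; apply: seq_end_ext => v i /=; rewrite add0r. Qed.
Lemma seq_endND : left_inverse seq_end0 seq_endN seq_endD.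
Proof. by move=> f; apply: seq_end_ext => v i /=; rewrite addNr. Qed.

HB.instance Definition _ :=
  GRing.isZmodule.Build seq_end seq_endDA seq_endDC seq_end0D seq_endND.

Lemma seq_endMA : associative seq_endM.
Proof. by move=> f g h; apply: seq_end_ext. Qed.
Lemma seq_end1M : left_id seq_end1 seq_endM.
Proof. by move=> f; apply: seq_end_ext. Qed.
Lemma seq_endM1 : right_id seq_end1 seq_endM.
Proof. by move=> f; apply: seq_end_ext. Qed.
Lemma seq_endMDl : left_distributive seq_endM seq_endD.
Proof. by move=> f g h; apply: seq_end_ext. Qed.
Lemma seq_endMDr : right_distributive seq_endM seq_endD.
Proof. by move=> f g h; apply: seq_end_ext => v i /=; rewrite seq_endDE. Qed.
Lemma seq_end1_neq0 : seq_end1 != 0 :> seq_end.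
Proof.
apply/eqP => /(congr1 (fun f : seq_end => f (fun=> 1) 0)) /= /eqP.
by rewrite oner_eq0.
Qed.

HB.instance Definition _ := GRing.Zmodule_isNzRing.Build seq_end
  seq_endMA seq_end1M seq_endM1 seq_endMDl seq_endMDr seq_end1_neq0.

Lemma seq_endZA a b f : seq_endZ a (seq_endZ b f) = seq_endZ (a * b) f.
Proof. by apply: seq_end_ext => v i /=; rewrite scalerA. Qed.
Lemma seq_end1Z : left_id 1 seq_endZ.
Proof. by move=> f; apply: seq_end_ext => v i /=; rewrite scale1r. Qed.
Lemma seq_endZDr : right_distributive seq_endZ +%R.
Proof. by move=> a f g; apply: seq_end_ext => v i /=; rewrite scalerDr. Qed.
Lemma seq_endZDl f : {morph seq_endZ^~ f : a b / a + b}.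
Proof. by move=> a b; apply: seq_end_ext => v i /=; rewrite scalerDl. Qed.

HB.instance Definition _ := GRing.Zmodule_isLmodule.Build K seq_end
  seq_endZA seq_end1Z seq_endZDr seq_endZDl.

Lemma seq_end_scalerAl (a : K) (f g : seq_end) : a *: (f * g) = a *: f * g.
Proof. exact: seq_end_ext. Qed.
HB.instance Definition _ :=
  GRing.Lmodule_isLalgebra.Build K seq_end seq_end_scalerAl.

Lemma seq_end_scalerAr (a : K) (f g : seq_end) : a *: (f * g) = f * (a *: g).
Proof. by apply: seq_end_ext => v i /=; rewrite seq_endZE. Qed.
HB.instance Definition _ :=
  GRing.Lalgebra_isAlgebra.Build K seq_end seq_end_scalerAr.

End LinearEndomorphisms.

Section SkewShift.
Variables (K : fieldType) (L : comUnitAlgType K).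
Variables (sigma sigmainv : {lrmorphism L -> L}).
Hypotheses (Hs1 : cancel sigma sigmainv) (Hs2 : cancel sigmainv sigma).
Variable a : L.

(** The integer power [sigma^i]; [Negz n] stands for [-(n+1)]. *)
Definition twist (i : int) (d : L) : L :=
  match i with Posz n => iter n sigma d | Negz n => iter n.+1 sigmainv d end.

Lemma twistD1 i d : twist (i + 1) d = twist i (sigma d).
Proof.
case: i => n; first by rewrite -PoszD addn1 /= -iterSr.
case: n => [|n]; first by rewrite /= Hs1.
have -> : Negz n.+1 + 1 = Negz n.
  by rewrite !NegzE -[n.+2]addn1 PoszD opprD addrNK.
by rewrite /twist [in RHS]iterSr Hs1.
Qed.

Lemma twistB1 i d : twist (i - 1) d = twist i (sigmainv d).
Proof. by rewrite -[in RHS](subrK 1 i) twistD1 Hs2. Qed.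

Lemma twist_linear i (c : K) d e : twist i (c *: d + e) = c *: twist i d + twist i e.
Proof. by case: i => n; rewrite /twist; [elim: n|elim: n.+1] => //= m ->; rewrite linearP. Qed.

Lemma twistM i d e : twist i (d * e) = twist i d * twist i e.
Proof. by case: i => n; rewrite /twist; [elim: n|elim: n.+1] => //= m ->; rewrite rmorphM. Qed.

Lemma twist1 i : twist i 1 = 1.
Proof. by case: i => n; rewrite /twist; [elim: n|elim: n.+1] => //= m ->; rewrite rmorph1. Qed.

Lemma skew_iota_subproof (d : L) (c : K) (u v : int -> L) :
  (fun i => twist i d * (c *: u i + v i)) =
  (fun i => c *: (twist i d * u i) + twist i d * v i).
Proof. by apply/funext => i; rewrite mulrDr scalerAr. Qed.

(** Multiplying position [i] by [sigma^i(d)] makes the shift [skew_x] satisfy [x d = sigma(d) x]. *)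
Definition skew_iota (d : L) : seq_end L :=
  SeqEnd (seq_end_fun := fun v i => twist i d * v i) (skew_iota_subproof d).

Definition skew_x : seq_end L :=
  @SeqEnd K L (fun v i => v (i + 1)) (fun _ _ _ => erefl).

Definition skew_y : seq_end L := skew_iota a *
  @SeqEnd K L (fun v i => v (i - 1)) (fun _ _ _ => erefl).

Lemma skew_iota_linear : linear skew_iota.
Proof.
move=> c d e; apply: seq_end_ext => v i /=.
by rewrite twist_linear mulrDl scalerAl.
Qed.

Lemma skew_iota_monoid : monoid_morphism skew_iota.
Proof.
split; first by apply: seq_end_ext => v i /=; rewrite twist1 mul1r.
by move=> d e; apply: seq_end_ext => v i /=; rewrite twistM mulrA.
Qed.

HB.instance Definition _ :=
  GRing.isLinear.Build K L (seq_end L) _ skew_iota skew_iota_linear.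
HB.instance Definition _ :=
  GRing.isMonoidMorphism.Build L (seq_end L) skew_iota skew_iota_monoid.

Lemma skew_gwa_rel : gwa_rel sigma sigmainv a skew_iota skew_x skew_y.
Proof.
split; [|split; [|split]].
- by move=> d; apply: seq_end_ext => v i /=; rewrite twistD1.
- by move=> d; apply: seq_end_ext => v i /=; rewrite twistB1 mulrCA.
- by apply: seq_end_ext => v i /=; rewrite subrK.
- by apply: seq_end_ext => v i /=; rewrite addrK twistD1.
Qed.

Lemma skew_xX (j : nat) v i : (skew_x ^+ j) v i = v (i + j%:Z).
Proof.
elim: j i => [|j IH] i; first by rewrite addr0.
by rewrite exprS /= IH -addrA -PoszD.
Qed.

End SkewShift.

(** * Subalgebras, and induction on the generators of a generalized Weyl algebra *)

Section Subalgebra.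
Variables (K : fieldType) (A : algType K) (P : {pred A}).
Hypothesis PP : GRing.subsemialg_closed P.

(* The closure proof indexes the type so that the algebra instance below can
   be inferred from it. *)
Record subalg (closedP : GRing.subsemialg_closed P) :=
  Subalg {subalg_val : A; _ : subalg_val \in P}.
HB.instance Definition _ := [isSub for @subalg_val PP].
HB.instance Definition _ := [Choice of subalg PP by <:].
HB.instance Definition _ :=
  GRing.SubChoice_isSubAlgebra.Build K A P (subalg PP) PP.

Definition subalg_incl (v : subalg PP) : A := subalg_val v.

Lemma subalg_incl_linear : linear subalg_incl.
Proof. by []. Qed.
Lemma subalg_incl_monoid : monoid_morphism subalg_incl.
Proof. by []. Qed.
HB.instance Definition _ :=
  GRing.isLinear.Build K (subalg PP) A _ subalg_incl subalg_incl_linear.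
HB.instance Definition _ :=
  GRing.isMonoidMorphism.Build (subalg PP) A subalg_incl subalg_incl_monoid.

Variables (D : algType K) (f : {lrmorphism D -> A}).
Hypothesis Pf : forall d, f d \in P.

Definition corestr (d : D) : subalg PP := Subalg PP (Pf d).

Lemma corestr_linear : linear corestr.
Proof. by move=> c u v; apply: val_inj; rewrite /= linearP. Qed.
Lemma corestr_monoid : monoid_morphism corestr.
Proof.
by split=> [|u v]; apply: val_inj; rewrite /= ?rmorph1 ?rmorphM.
Qed.
HB.instance Definition _ :=
  GRing.isLinear.Build K D (subalg PP) _ corestr corestr_linear.
HB.instance Definition _ :=
  GRing.isMonoidMorphism.Build D (subalg PP) corestr corestr_monoid.

End Subalgebra.

Section GWA.
Variables (K : fieldType) (L : comUnitAlgType K).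
Variables (sigma sigmainv : {lrmorphism L -> L}) (a : L).
Variables (A : algType K) (iota : {lrmorphism L -> A}) (x y : A).
Hypothesis HA : is_gwa sigma sigmainv a iota x y.

(* By initiality, the inclusion of a subalgebra containing the generators has
   a section, hence is onto. *)
Lemma gwa_ind (P : A -> Prop) : P 1 ->
  (forall (c : K) u v, P u -> P v -> P (c *: u + v)) ->
  (forall u v, P u -> P v -> P (u * v)) ->
  (forall d, P (iota d)) -> P x -> P y -> forall v, P v.
Proof.
move=> P1 PZD PM Pi Px Py v.
have P0 : P 0 by rewrite -(addNr 1) -scaleN1r; apply: PZD.
pose Q : {pred A} := fun v => `[< P v >].
have QP : GRing.subsemialg_closed Q.
  split; first exact/asboolP.
  - split; first exact/asboolP.
    move=> u w /asboolP Pu /asboolP Pw; apply/asboolP.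
    by rewrite -[u]scale1r; apply: PZD.
  - by move=> c u /asboolP Pu; apply/asboolP; rewrite -[_ *: _]addr0; apply: PZD.
  - by move=> u w /asboolP Pu /asboolP Pw; apply/asboolP/PM.
have Qi d : iota d \in Q by apply/asboolP.
pose B := subalg QP.
pose i : {lrmorphism L -> B} := corestr QP Qi.
pose x' : B := Subalg QP (asboolT Px : x \in Q).
pose y' : B := Subalg QP (asboolT Py : y \in Q).
have [[xd [yd [yx xy]]] univ] := HA.
have [|f [[fi [fx fy]] _]] := univ B i x' y'.
  split; [|split; [|split]].
  - by move=> d; apply: val_inj; rewrite /= xd.
  - by move=> d; apply: val_inj; rewrite /= yd.
  - by apply: val_inj; rewrite /= yx.
  - by apply: val_inj; rewrite /= xy.
(* Both the identity and the inclusion composed with [f] fix the generators, so both equal [g], and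
   every [v] lies in the image of the inclusion. *)
have [g [_ guniq]] := univ A iota x y HA.1.
pose h : {lrmorphism A -> A} := @subalg_incl K A Q QP \o f.
have hv : h v = g v by apply: guniq => [d||]; rewrite /h /= ?fi ?fx ?fy.
have -> : v = h v by rewrite hv; apply: (guniq idfun).
exact/asboolP/(valP (f v)).
Qed.
End GWA.

(** * Powers of integer matrices *)

Section IntegerMatrices.
Variables (n : nat) (M : 'M[int]_n).

Definition finite_order := exists m : nat, (0 < m)%N /\ M ^+ m = 1%:M.
Definition power_bounded := exists N : int, 0 < N /\
  forall m : nat, (0 < m)%N -> forall i j, `|(M ^+ m) i j| < N.

Hypothesis injM : forall u : 'cV[int]_n, M *m u = 0 -> u = 0.

Lemma exprmx_inj i (u : 'cV[int]_n) : M ^+ i *m u = 0 -> u = 0.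
Proof.
elim: i u => [|i IH] u; first by rewrite expr0 mul1mx.
by rewrite exprS -mulmxE -mulmxA => /injM/IH.
Qed.

(** The difference is [M^i (M^(j-i) - 1) = 0], and [M^i] kills no nonzero column. *)
Lemma exprmx_collision i j : (i < j)%N -> M ^+ i = M ^+ j -> finite_order.
Proof.
move=> ij E; exists (j - i)%N; rewrite subn_gt0; split=> //.
apply/eqP; rewrite -subr_eq0; apply/eqP/matrixP => p q.
have /(congr1 (col q)) : M ^+ i *m (M ^+ (j - i) - 1%:M) = 0.
  by rewrite mulmxBr mulmx1 mulmxE -exprD subnKC ?(ltnW ij) // -E subrr.
by rewrite colE -mulmxA -colE col0 => /exprmx_inj/colP/(_ p); rewrite !mxE.
Qed.

(** Pigeonhole: there are at most [(2g)^(n^2)] integer matrices with all entries below [g] in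
    absolute value, so one more power than that would force two equal powers and hence finite
    order. *)
Lemma exprmx_large_entry (g : nat) : ~ finite_order ->
  exists i p q, [/\ (0 < i)%N, (i <= ((2 * g) ^ (n * n)).+1)%N &
    (g <= `|(M ^+ i) p q|)%N].
Proof.
move=> noM; apply: contrapT => small.
have lt_g (i : 'I_((2 * g) ^ (n * n)).+1) p q : (`|(M ^+ i.+1) p q| < g)%N.
  rewrite ltnNge; apply/negP => gle; apply: small.
  by exists i.+1, p, q; split=> //; rewrite ltnS ltnW.
(* Adding [g] moves the entries into the range below [2g]; the form [.-1.+1] makes the ordinal type
   inhabited, as [inord] requires. *)
pose F (i : 'I_((2 * g) ^ (n * n)).+1) : 'M['I_(2 * g).-1.+1]_n :=
  \matrix_(p, q) inord `|(M ^+ i.+1) p q + g%:Z|.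
have : ~~ injectiveb F.
  apply/negP => /injectiveP/leq_card; rewrite card_ord card_mx card_ord => le_card.
  (* The cardinality comparison needs [2g > 0]. For [n = 0] every matrix is the identity, and for
     [g = 0] no entry can be smaller than [g]. *)
  case: (posnP n) => [n0|n0].
    by apply: noM; exists 1%N; split=> //; apply/matrixP => p; have := ltn_ord p; rewrite {2}n0.
  case: (posnP g) => [g0|g0].
    by have := lt_g ord0 (Ordinal n0) (Ordinal n0); rewrite g0.
  by move: le_card; rewrite prednK ?muln_gt0 // ltnn.
case/injectivePn => i [j ne Eij]; apply: noM.
suff E : M ^+ i.+1 = M ^+ j.+1.
  have : i.+1 != j.+1 by [].
  by rewrite neq_ltn => /orP[] lt; apply: exprmx_collision lt _.
apply/matrixP => p q; move/matrixP: Eij => /(_ p q); rewrite !mxE.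
move/(congr1 val); have := lt_g i p q; have := lt_g j p q.
by rewrite /= => lt1 lt2; rewrite !inordK; lia.
Qed.

Lemma power_bounded_finite_order : power_bounded -> finite_order.
Proof.
case=> N [N0 HN]; apply: contrapT => /(@exprmx_large_entry `|N|) [i [p [q [i0 _]]]].
by have := HN i i0 p q; lia.
Qed.

Lemma finite_order_power_bounded : finite_order -> power_bounded.
Proof.
case=> m [m0 Mm].
exists (\sum_(i < m) \sum_p \sum_q `|(M ^+ i) p q| + 1); split.
  by rewrite ltr_pwDr // !sumr_ge0 // => i _; rewrite !sumr_ge0 // => p _; rewrite sumr_ge0.
move=> l _ p q; rewrite ltzD1.
have -> : M ^+ l = M ^+ (l %% m).
  by rewrite [in LHS](divn_eq l m) exprD mulnC exprM Mm expr1n mul1r.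
rewrite (bigD1 (Ordinal (ltn_pmod l m0))) //= (bigD1 p) //= (bigD1 q) //=.
rewrite -!addrA lerDl !addr_ge0 // ?sumr_ge0 // => i _; rewrite !sumr_ge0 // => *.
by rewrite sumr_ge0.
Qed.

End IntegerMatrices.

(** * Laurent monomials under an automorphism *)

Section Laurent.
Variables (K : fieldType) (n : nat) (L : comUnitAlgType K) (z : 'I_n -> L).
Hypothesis HL : is_laurent_alg z.
Implicit Types (u v : 'cV[int]_n) (f g : L).

Lemma lmonoD u v : lmono z (u + v) = lmono z u * lmono z v.
Proof.
rewrite /lmono -big_split; apply: eq_bigr => j _.
by rewrite mxE exprzDr //; exact: HL.1.
Qed.

Lemma lmono0 : lmono z 0 = 1.
Proof. by rewrite /lmono big1 // => j _; rewrite mxE expr0z. Qed.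

Lemma lmono_unit u : lmono z u \is a GRing.unit.
Proof.
by apply/unitrP; exists (lmono z (- u)); rewrite -!lmonoD addNr addrN lmono0.
Qed.

Lemma lmonoN u : lmono z (- u) = (lmono z u)^-1.
Proof.
by apply: (mulIr (lmono_unit u)); rewrite -lmonoD addNr lmono0 mulVr ?lmono_unit.
Qed.

Lemma lmono_indep (I : eqType) (r : seq I) (U : I -> 'cV[int]_n) (c : I -> K) :
  uniq r -> {in r &, injective U} ->
  \sum_(i <- r) c i *: lmono z (U i) = 0 -> forall i, i \in r -> c i = 0.
Proof.
move=> ur injU Hc i ir; have uU : uniq (map U r) by rewrite map_inj_in_uniq.
have := HL.2.2 _ uU; rewrite /lin_indep -map_comp size_map.
move/(_ (fun j => c (nth i r j))) => H.
have Hi : (index i r < size r)%N by rewrite index_mem.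
have := H _ (Ordinal Hi); rewrite /= nth_index //; apply.
rewrite -[RHS]Hc (big_nth i) big_mkord.
by apply: eq_bigr => j _; rewrite (nth_map i).
Qed.

Lemma lmono_span f : exists us, in_span [seq lmono z u | u <- us] f.
Proof.
have [us [c ->]] := HL.2.1 f; exists us; apply: in_span_sum => i _.
by apply/in_spanZ/in_span_mem/map_f/mem_nth.
Qed.

Lemma lmono_span_seq (s : seq L) : exists us, forall f, f \in s ->
  in_span [seq lmono z u | u <- us] f.
Proof.
elim: s => [|f t [us IH]]; first by exists [::].
have [us' Hf] := lmono_span f; exists (us' ++ us) => v.
rewrite inE map_cat => /orP[/eqP -> | /IH Hv].
  by apply: in_span_trans Hf => w Hw; apply: in_span_mem; rewrite mem_cat Hw.
by apply: in_span_trans Hv => w Hw; apply: in_span_mem; rewrite mem_cat Hw orbT.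
Qed.

(** Otherwise adjoining [v] to the distinct exponents of [us] would give an independent family
    larger than one that spans it. *)
Lemma lmono_in_span us v : in_span [seq lmono z u | u <- us] (lmono z v) -> v \in us.
Proof.
move=> Hv; apply: contraT => vus.
have /HL.2.2 : uniq (v :: undup us) by rewrite /= mem_undup vus undup_uniq.
move/(@lin_indep_size_le _ _ _ [seq lmono z u | u <- undup us]).
rewrite !size_map /= ltnn; apply=> w.
have sub t : in_span [seq lmono z u | u <- us] t ->
             in_span [seq lmono z u | u <- undup us] t.
  apply: in_span_trans => _ /mapP[u uin ->].
  by apply/in_span_mem/map_f; rewrite mem_undup.
rewrite inE => /orP[/eqP ->|/in_span_mem //]; exact: sub.
Qed.

Lemma lmono_inj u v (c : K) : lmono z u = c *: lmono z v -> u = v.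
Proof.
move=> E; have : in_span [seq lmono z u | u <- [:: v]] (lmono z u).
  by rewrite E; apply/in_spanZ/in_span_mem; rewrite inE.
by move/lmono_in_span; rewrite inE => /eqP.
Qed.

(** Only exponents matter in what follows, so the scalars produced by [sigma] are hidden under an
    existential. *)
Definition is_mono f u := exists2 c : K, c != 0 & f = c *: lmono z u.

Lemma is_mono_lmono u : is_mono (lmono z u) u.
Proof. by exists 1; rewrite ?oner_eq0 ?scale1r. Qed.

Lemma is_monoZ (c : K) f u : c != 0 -> is_mono f u -> is_mono (c *: f) u.
Proof. by move=> c0 [d d0 ->]; exists (c * d); rewrite ?mulf_neq0 ?scalerA. Qed.

Lemma is_monoM f g u v : is_mono f u -> is_mono g v -> is_mono (f * g) (u + v).
Proof.
case=> c c0 -> [d d0 ->]; exists (c * d); first by rewrite mulf_neq0.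
by rewrite lmonoD -scalerAl -scalerAr scalerA.
Qed.

Lemma is_monoX f u (l : int) : is_mono f u -> is_mono (f ^ l) (l *: u).
Proof.
move=> fu; have fX (k : nat) : is_mono (f ^+ k) (k%:Z *: u).
  elim: k => [|k IH]; first by rewrite expr0 scale0r -lmono0; exact: is_mono_lmono.
  by rewrite exprS intS scalerDl scale1r; exact: is_monoM.
case: l => k; first exact: fX.
have -> : f ^ Negz k = (f ^+ k.+1)^-1 by [].
rewrite NegzE scaleNr; have [c c0 ->] := fX k.+1.
exists c^-1; first by rewrite invr_eq0.
by rewrite invrZ ?lmono_unit ?unitfE // lmonoN.
Qed.

Lemma is_mono_prod (I : Type) (r : seq I) (F : I -> L) (U : I -> 'cV[int]_n) :
  (forall i, is_mono (F i) (U i)) ->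
  is_mono (\prod_(i <- r) F i) (\sum_(i <- r) U i).
Proof.
move=> H; elim/big_rec2: _ => [|i u f _ fu]; last exact: is_monoM.
by rewrite -lmono0; exact: is_mono_lmono.
Qed.

Section Automorphism.
Variables (sigma sigmainv : {lrmorphism L -> L}).
Hypotheses (Hs1 : cancel sigma sigmainv) (Hs2 : cancel sigmainv sigma).
Variables (alpha : 'I_n -> K) (M : 'M[int]_n).
Hypotheses (Halpha : forall i, alpha i != 0)
  (HM : forall i, sigma (z i) = alpha i *: lmono z (col i M)).

Lemma sigma_mono u : is_mono (sigma (lmono z u)) (M *m u).
Proof.
rewrite /lmono rmorph_prod.
have -> : M *m u = \sum_j u j 0 *: col j M.
  apply/colP => i; rewrite mxE summxE; apply: eq_bigr => j _.
  by rewrite !mxE mulrC.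
apply: is_mono_prod => j; rewrite rmorphXz; last exact: HL.1.
apply: is_monoX; rewrite /= HM.
by apply: is_monoZ => //; exact: is_mono_lmono.
Qed.

Lemma sigma_is_mono f u : is_mono f u -> is_mono (sigma f) (M *m u).
Proof. by case=> c c0 ->; rewrite linearZ; apply/is_monoZ/sigma_mono. Qed.

(** Here [M^(m-1)] inverts [M], so [sigma] sends the monomial of exponent [M^(m-1) u] to a nonzero
    multiple of [z^u]. *)
Lemma sigmainv_mono m : (0 < m)%N -> M ^+ m = 1%:M ->
  forall u, is_mono (sigmainv (lmono z u)) (M ^+ m.-1 *m u).
Proof.
move=> m0 Mm u; have [c c0] := sigma_mono (M ^+ m.-1 *m u).
rewrite mulmxA mulmxE -exprS prednK // Mm mul1mx => /(congr1 sigmainv).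
rewrite Hs1 linearZ => /(congr1 ( *:%R c^-1)); rewrite scalerK // => <-.
by exists c^-1; rewrite ?invr_eq0.
Qed.

Lemma iter_sigma_mono i f u : is_mono f u -> is_mono (iter i sigma f) (M ^+ i *m u).
Proof.
move=> fu; elim: i => [|i IH]; first by rewrite expr0 mul1mx.
by rewrite exprS -mulmxE -mulmxA /=; exact: sigma_is_mono.
Qed.

(** If [M u = 0] then [sigma(z^u)] is a scalar, which [sigma] fixes; injectivity of [sigma] makes
    [z^u] that scalar. *)
Lemma exponent_matrix_inj u : M *m u = 0 -> u = 0.
Proof.
move=> Mu; have [c _] := sigma_mono u; rewrite Mu lmono0 -(rmorph1 sigma) -linearZ.
move/(can_inj Hs1); rewrite -lmono0; exact: lmono_inj.
Qed.

Lemma locally_algebraic_power_bounded : locally_algebraic sigma -> power_bounded M.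
Proof.
move=> /(_ [seq z i | i <- enum 'I_n]) [t [zt [st _]]].
have [us /in_span_trans Hus] := lmono_span_seq t.
(* The orbit of [z q] stays in the stable space spanned by [t], and its [m]-th member has as
   exponent column [q] of [M^m]; hence all these columns lie in the finite support [us]. *)
have Mus m q : col q (M ^+ m) \in us.
  have zq : is_mono (z q) (delta_mx q 0).
    suff -> : z q = lmono z (delta_mx q 0) by exact: is_mono_lmono.
    rewrite /lmono (bigD1 q) //= mxE !eqxx expr1z big1 ?mulr1 // => j /negbTE nj.
    by rewrite mxE nj expr0z.
  have [c c0 E] := iter_sigma_mono m zq.
  rewrite colE; apply: lmono_in_span; rewrite -[lmono z _](scalerK c0) -E.
  apply/in_spanZ/Hus; elim: m {E} => [|m IH] /=; last exact: st.
  by apply: zt; apply/map_f; rewrite mem_enum.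
exists (\sum_(u <- us) \sum_i `|u i 0| + 1); split.
  by rewrite ltr_pwDr // sumr_ge0 // => u _; rewrite sumr_ge0.
move=> m _ p q; rewrite ltzD1 (big_rem _ (Mus m q)) /= (bigD1 p) //= mxE -addrA lerDl.
by rewrite addr_ge0 ?sumr_ge0 // => u _; rewrite sumr_ge0.
Qed.

Lemma finite_order_locally_algebraic : finite_order M -> locally_algebraic sigma.
Proof.
case=> m [m0 Mm] s.
have [us Hus] := lmono_span_seq s.
(* The union of the [M]-orbits of the exponents occurring in [s], finite since [M^m = 1]. *)
pose ts := [seq M ^+ i *m u | i <- iota 0 m, u <- us].
have stable u i : u \in ts -> M ^+ i *m u \in ts.
  case/allpairsP=> -[j w] /= [_ wus ->].
  rewrite mulmxA mulmxE -exprD.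
  have -> : M ^+ (i + j) = M ^+ ((i + j) %% m).
    by rewrite [in LHS](divn_eq (i + j) m) exprD mulnC exprM Mm expr1n mul1r.
  by apply: allpairs_f => //; rewrite mem_iota add0n ltn_pmod.
exists [seq lmono z u | u <- ts]; split; last split.
- move=> v /Hus; apply: in_span_trans => _ /mapP[u uin ->].
  apply/in_span_mem/map_f; apply/allpairsP; exists (0%N, u).
  by rewrite /= mem_iota add0n m0 expr0 mul1mx.
- apply: in_span_linear => _ /mapP[u uin ->].
  rewrite /=; have [c c0 ->] := sigma_mono u; apply/in_spanZ/in_span_mem/map_f.
  by have := stable u 1%N uin; rewrite expr1.
- move=> f Hf; exists (sigmainv f); rewrite Hs2; split=> //.
  move: f Hf; apply: in_span_linear => _ /mapP[u uin ->].
  rewrite /=; have [c c0 ->] := sigmainv_mono m0 Mm u.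
  by apply/in_spanZ/in_span_mem/map_f/stable.
Qed.

End Automorphism.
End Laurent.

(** * Growth of the generalized Weyl algebra *)

Lemma seq_end_sumE (K : fieldType) (L : algType K) (I : Type) (r : seq I)
    (F : I -> seq_end L) v i :
  (\sum_(j <- r) F j) v i = \sum_(j <- r) F j v i.
Proof. by elim/big_rec2: _ => //= j y f _ <-. Qed.

Definition l1norm n (u : 'cV[int]_n) : nat := (\sum_p `|u p 0%R|)%N.

(** * Independent words and the lower bound *)

Section LowerBound.
Variables (K : fieldType) (n : nat) (L : comUnitAlgType K) (z : 'I_n -> L).
Hypothesis HL : is_laurent_alg z.
Variables (sigma sigmainv : {lrmorphism L -> L}).
Hypotheses (Hs1 : cancel sigma sigmainv) (Hs2 : cancel sigmainv sigma).
Variables (alpha : 'I_n -> K) (M : 'M[int]_n).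
Hypotheses (Halpha : forall i, alpha i != 0)
  (HM : forall i, sigma (z i) = alpha i *: lmono z (col i M)).
Variables (a : L) (A : algType K) (iota : {lrmorphism L -> A}) (x y : A).
Hypothesis HA : is_gwa sigma sigmainv a iota x y.

Lemma gwa_monomials_indep (I : eqType) (r : seq I) (U : I -> 'cV[int]_n)
    (J : I -> nat) (c : I -> K) :
  uniq r -> {in r &, injective (fun i => (U i, J i))} ->
  \sum_(i <- r) c i *: (iota (lmono z (U i)) * x ^+ J i) = 0 ->
  forall i, i \in r -> c i = 0.
Proof.
move=> ur inj sum0 i ir.
have [f [[fi [fx _]] _]] := HA.2 _ _ _ _ (skew_gwa_rel Hs1 Hs2 a).
(* Acting on the indicator of position [J i] and reading position 0 keeps just the terms of
   [x]-degree [J i], leaving a relation between Laurent monomials. *)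
have /(congr1 (fun F : seq_end L => F (fun l => (l == (J i)%:Z)%:R) 0)) :=
  congr1 f sum0.
rewrite linear_sum linear0 seq_end_sumE /=.
under eq_bigr => j _ do
  rewrite linearZ rmorphM rmorphXn /= fi fx /= skew_xX add0r eqz_nat mulr_natr mulrb.
move=> {}sum0.
apply: (@lmono_indep _ _ _ _ HL _ [seq j <- r | J j == J i] U).
- exact: filter_uniq.
- move=> j l; rewrite !mem_filter => /andP[/eqP jJ jr] /andP[/eqP lJ lr] Ujl.
  by apply: inj => //; rewrite Ujl jJ lJ.
- rewrite big_filter big_mkcond -[RHS]sum0; apply: eq_bigr => j _.
  by case: ifP; rewrite ?scaler0.
- by rewrite mem_filter eqxx.
Qed.

Lemma gwa_xX_iota j d : x ^+ j * iota d = iota (iter j sigma d) * x ^+ j.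
Proof.
elim: j d => [|j IH] d; first by rewrite !expr0 mulr1 mul1r.
by rewrite exprSr -mulrA HA.1.1 mulrA IH -iterSr mulrA.
Qed.

Definition gwa_gens : seq A :=
  x :: [seq iota (z i) | i <- enum 'I_n] ++ [seq iota (z i)^-1 | i <- enum 'I_n].

Lemma iota_lmono_words (u : 'cV[int]_n) :
  iota (lmono z u) \in words_upto gwa_gens (l1norm u).
Proof.
rewrite /l1norm /lmono rmorph_prod; elim/big_rec2: _ => [|i m w _ IH]; first exact: words_upto1.
apply: words_uptoM IH; case: (u i 0) => k.
  rewrite -exprnP rmorphXn; apply: words_uptoX.
  by rewrite inE mem_cat (map_f (fun i => iota (z i))) ?mem_enum ?orbT.
have -> : z i ^ Negz k = (z i)^-1 ^+ k.+1 by rewrite exprVn.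
rewrite rmorphXn; apply: words_uptoX.
by rewrite inE mem_cat (map_f (fun i => iota (z i)^-1)) ?mem_enum ?orbT.
Qed.

(** The [g] translates of a box of side [m] by multiples of [h M^i w] are disjoint: a coordinate of
    [M^i w] has size at least [g], and [h g >= m]. With [m] choices for the degree in [x] this gives
    [g m^(n+1)] independent words. The alternative [g = 1] uses the box alone. *)
Lemma gwa_growth_ge (m g i : nat) (w : 'cV[int]_n) :
  (0 < g)%N -> (g <= m)%N -> (i <= m)%N -> (l1norm w <= 1)%N ->
  g = 1%N \/ (exists p, g <= `|((M ^+ i *m w) p 0)%R|)%N ->
  (g * m ^ n.+1 <= dim_span (words_upto gwa_gens ((n + 4) * m)))%N.
Proof.
move=> g0 gm im w1 Hg.
(* Large enough for [h g >= m], which separates the boxes, and small enough for [h g <= 2m], which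
   keeps the words of length linear in [m]. *)
pose h := (m %/ g).+1.
have hg_ge : (m <= h * g)%N by apply: ltnW; exact: ltn_ceil.
have hg_le : (h * g <= 2 * m)%N.
  by rewrite /h mulSn mul2n -addnn leq_add // leq_trunc_div.
pose I := ({ffun 'I_n -> 'I_m} * 'I_g * 'I_m)%type.
pose vec (f : {ffun 'I_n -> 'I_m}) : 'cV[int]_n := \col_p (f p : nat)%:Z.
pose s (l : 'I_g) : int := (l * h)%N%:Z.
pose U (e : I) := vec e.1.1 + s e.1.2 *: (M ^+ i *m w).
pose J (e : I) := (m + e.2)%N.
(* Moving [x^i] to the right turns the exponent [s w] into [s M^i w], so a short word reaches a far
   exponent. The offset [m] in [J] makes [J e - i] an exact subtraction. *)
pose W (e : I) : A := iota (lmono z (vec e.1.1)) * x ^+ i *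
  (iota (lmono z (s e.1.2 *: w)) * x ^+ (J e - i)).
have WE e : exists c : K, c != 0 /\ W e = c *: (iota (lmono z (U e)) * x ^+ J e).
  have : is_mono z (lmono z (vec e.1.1) * iter i sigma (lmono z (s e.1.2 *: w))) (U e).
    rewrite /U scalemxAr; apply: (is_monoM HL); first exact: is_mono_lmono.
    by apply: (iter_sigma_mono HL Halpha HM); exact: is_mono_lmono.
  case=> c c0 E; exists c; split=> //.
  rewrite /W mulrA -[_ * x ^+ i * _]mulrA gwa_xX_iota !mulrA -rmorphM E -mulrA -exprD.
  have iJ : (i <= J e)%N by apply: leq_trans im _; exact: leq_addr.
  by rewrite subnKC //= linearZ scalerAl.
have injUJ : injective (fun e => (U e, J e)).
  move=> [[f l] j] [[f' l'] j'] [EU /addnI /val_inj /= ->].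
  have EUp p : (f p : nat)%:Z + s l * (M ^+ i *m w) p 0 =
               (f' p : nat)%:Z + s l' * (M ^+ i *m w) p 0.
    by move/colP: EU => /(_ p); rewrite !mxE.
  have El : l = l'.
    case: Hg => [g1|[p Hp]].
      by apply/val_inj; case: (l) (l') => [b Hb] [b' Hb'] /=; lia.
    apply/val_inj/eqP; apply: contraT => ne.
    have := EUp p; rewrite /s; have := ltn_ord (f p); have := ltn_ord (f' p).
    move: Hp; set v := (M ^+ i *m w) p 0 => Hp lt1 lt2 E.
    have {}E : (l%:Z - l'%:Z) * (h%:Z * v) = (f' p : nat)%:Z - (f p : nat)%:Z.
      by move: E; rewrite !PoszM; lia.
    (* For [l != l'] this contradicts that the same number is a difference of two naturals below
       [m]. *)
    have : (m <= `|((l%:Z - l'%:Z) * (h%:Z * v))%R|)%N.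
      rewrite abszM abszM absz_nat; apply: leq_trans hg_ge _.
      apply: leq_trans (leq_pmull _ _); first by rewrite leq_mul2l Hp orbT.
      by move: ne; rewrite /= => ne; lia.
    by rewrite E; lia.
  congr (_, _, _) => //; apply/ffunP => p; apply: val_inj.
  by have := EUp p; rewrite El => /addIr [].
have /choice[c Hc] := WE.
have -> : (g * m ^ n.+1)%N = size [seq W e | e <- enum (predT : pred I)].
  by rewrite size_map -cardE !card_prod card_ffun !card_ord expnSr; lia.
apply: dim_span_ge.
  apply: lin_indep_map; first exact: enum_uniq.
  move=> d Hd e He.
  suff /eqP : d e * c e = 0 by rewrite mulf_eq0 (negbTE (Hc e).1) orbF => /eqP.
  apply: (@gwa_monomials_indep _ (enum (predT : pred I)) U J (fun e => d e * c e)) => //.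
  - exact: enum_uniq.
  - by move=> ? ? _ _; exact: injUJ.
  - by rewrite -[RHS]Hd; apply: eq_bigr => l _; rewrite -scalerA -(Hc l).2.
move=> _ /mapP[[[f l] j] _ ->].
have xg : x \in gwa_gens by exact: mem_head.
have := words_uptoM (words_uptoM (iota_lmono_words (vec f)) (words_uptoX i xg))
  (words_uptoM (iota_lmono_words (s l *: w)) (words_uptoX (J (f, l, j) - i) xg)).
apply: words_upto_mono.
(* The four factors have lengths at most [n m], [i], [2m] and [m + j - i] with [j < m], whence the
   constant [n + 4]. *)
have : (l1norm (vec f) <= n * m)%N.
  rewrite /l1norm -[X in (_ <= X * m)%N]card_ord -sum_nat_const; apply: leq_sum => p _.
  by rewrite mxE absz_nat ltnW.
have : (l1norm (s l *: w)%R <= 2 * m)%N.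
  apply: (@leq_trans (l * h * l1norm w)).
    by rewrite /l1norm big_distrr; apply: leq_sum => p _; rewrite mxE abszM.
  apply: (@leq_trans (h * g * 1)); last by rewrite muln1.
  by apply: leq_mul => //; rewrite mulnC leq_mul2l ltnW ?orbT.
have := ltn_ord j; rewrite /J /=; lia.
Qed.

End LowerBound.

Lemma leq_absD (b d : int) : (`|(b + d)%R| <= `|b| + `|d|)%N.
Proof. lia. Qed.

(** * Size of exponents along orbits *)

Section OrbitBound.
Variables (n : nat) (M : 'M[int]_n).
Implicit Types (u v : 'cV[int]_n) (N : nat).

Definition orbit_le u N := forall i p, (`|((M ^+ i *m u) p 0)%R| <= N)%N.

Lemma orbit_leD u v N N' :
  orbit_le u N -> orbit_le v N' -> orbit_le (u + v) (N + N').
Proof.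
move=> Hu Hv i p; apply: leq_trans (leq_add (Hu i p) (Hv i p)).
by rewrite mulmxDr [X in (`|X| <= _)%N]mxE; exact: leq_absD.
Qed.

Lemma orbit_leX u N i : orbit_le u N -> orbit_le (M ^+ i *m u) N.
Proof. by move=> Hu j p; rewrite mulmxA mulmxE -exprD. Qed.

Lemma orbit_le_mono u N N' : (N <= N')%N -> orbit_le u N -> orbit_le u N'.
Proof. by move=> NN Hu i p; exact: leq_trans NN. Qed.

Lemma orbit_le0 : orbit_le 0 0.
Proof. by move=> i p; rewrite mulmx0 mxE. Qed.

Lemma power_bounded_orbit_le u : power_bounded M -> exists N, orbit_le u N.
Proof.
case=> B [B0 HB]; exists (\sum_q `|B| * `|u q 0%R|)%N => i p.
have HBi q : (`|(M ^+ i) p q| <= `|B|)%N.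
  (* Power-boundedness says nothing about exponent 0; there [B > 0] bounds the entries of the
     identity. *)
  case: i => [|i]; last by have := HB i.+1 isT p q; lia.
  by rewrite expr0 mxE; case: (p == q); lia.
rewrite mxE; elim/big_rec2: _ => // q N s _ le_s.
apply: leq_trans (leq_absD _ _) _; apply: leq_add le_s.
by rewrite abszM leq_mul.
Qed.

Lemma power_bounded_orbit_le_seq (us : seq 'cV[int]_n) : power_bounded M ->
  exists N, forall u, u \in us -> orbit_le u N.
Proof.
move=> HM; elim: us => [|v us [N IH]]; first by exists 0%N.
have [N' Hv] := power_bounded_orbit_le v HM.
exists (maxn N N') => u; rewrite inE => /orP[/eqP ->|/IH].
  by apply: orbit_le_mono Hv; exact: leq_maxr.
by apply: orbit_le_mono; exact: leq_maxl.
Qed.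

End OrbitBound.

(** * A filtration of dimension [O(N^(n+1))] *)

Section UpperBound.
Variables (K : fieldType) (n : nat) (L : comUnitAlgType K) (z : 'I_n -> L).
Hypothesis HL : is_laurent_alg z.
Variables (sigma sigmainv : {lrmorphism L -> L}).
Hypotheses (Hs1 : cancel sigma sigmainv) (Hs2 : cancel sigmainv sigma).
Variables (alpha : 'I_n -> K) (M : 'M[int]_n).
Hypotheses (Halpha : forall i, alpha i != 0)
  (HM : forall i, sigma (z i) = alpha i *: lmono z (col i M)).
Variables (a : L) (A : algType K) (iota : {lrmorphism L -> A}) (x y : A).
Hypothesis HA : is_gwa sigma sigmainv a iota x y.
Hypothesis finM : finite_order M.

Let xory (b : bool) : A := if b then x else y.
Let mono u b j : A := iota (lmono z u) * xory b ^+ j.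

(* A monomial z^u x^j or z^u y^j has weight (size of the M-orbit of u) + c * j;
   with c at least the orbit sizes of the supports of a and sigma a, the
   relations yx = a and xy = sigma a do not increase the weight. *)
Definition weight_le c N (u : 'cV[int]_n) (j : nat) :=
  exists N1, orbit_le M u N1 /\ (N1 + c * j <= N)%N.

(** Weight at most [N] confines the entries of [u] to [[-N, N]], coded by ordinals shifted by [N],
    so the family can be enumerated and counted. *)
Definition filtration_gens c N : seq A :=
  [seq mono (\col_p ((e.1.1 p : nat)%:Z - N%:Z)) e.1.2 e.2
     | e : {ffun 'I_n -> 'I_(2 * N).+1} * bool * 'I_N.+1 <-
       enum [pred e : {ffun 'I_n -> 'I_(2 * N).+1} * bool * 'I_N.+1 |
         `[< weight_le c N (\col_p ((e.1.1 p : nat)%:Z - N%:Z)) e.2 >]]].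

Lemma size_filtration_gens c N :
  (size (filtration_gens c N) <= (2 * N + 2) ^ n.+1)%N.
Proof.
rewrite size_map -cardE; apply: leq_trans (max_card _) _.
rewrite !card_prod card_ffun !card_ord card_bool expnSr -mulnA.
by apply: leq_mul; [case: (n) => // n'; rewrite leq_exp2r|]; lia.
Qed.

Lemma filtration_gensP c N w : w \in filtration_gens c N ->
  exists u b j, weight_le c N u j /\ w = mono u b j.
Proof.
case/mapP=> e; rewrite mem_enum inE => /asboolP/asboolP He ->.
by exists (\col_p ((e.1.1 p : nat)%:Z - N%:Z)), e.1.2, e.2.
Qed.

Lemma mem_filtration_gens c N u b j : (0 < c)%N -> weight_le c N u j ->
  mono u b j \in filtration_gens c N.
Proof.
move=> c0 Hw; have [N1 [Hu le]] := Hw.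
have jN : (j < N.+1)%N.
  by rewrite ltnS; apply: leq_trans le; apply: leq_trans (leq_addl _ _); exact: leq_pmull.
have uN p : (`|(u p 0 + N%:Z)%R| < (2 * N).+1)%N /\ 0 <= u p 0 + N%:Z.
  have : (`|u p 0%R| <= N1)%N by have := Hu 0%N p; rewrite expr0 mul1mx.
  have : (N1 <= N)%N by apply: leq_trans le; exact: leq_addr.
  by lia.
pose f := [ffun p => Ordinal (uN p).1].
have E : \col_p ((f p : nat)%:Z - N%:Z) = u.
  by apply/colP => p; rewrite mxE ffunE /= gez0_abs ?addrK //; exact: (uN p).2.
apply/mapP; exists (f, b, Ordinal jN); last by rewrite /= E.
by rewrite mem_enum inE /= E; apply/asboolP/asboolP.
Qed.

Section Filtration.
Variable c : nat.
Hypothesis c0 : (0 < c)%N.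
Let F N w := in_span (filtration_gens c N) w.

Lemma mono_filtration N u b j : weight_le c N u j -> F N (mono u b j).
Proof. by move=> Hw; apply/in_span_mem/mem_filtration_gens. Qed.

Lemma weight_le_mono N N' u j : (N <= N')%N -> weight_le c N u j -> weight_le c N' u j.
Proof.
by move=> NN [N1 [Hu le]]; exists N1; split=> //; exact: leq_trans NN.
Qed.

Lemma filtration_mono N N' w : (N <= N')%N -> F N w -> F N' w.
Proof.
move=> NN; apply: in_span_trans => _ /filtration_gensP[u [b [j [Hw ->]]]].
exact/mono_filtration/(weight_le_mono NN).
Qed.

Lemma filtration1 : F 0 1.
Proof.
have : weight_le c 0 0 0.
  by exists 0%N; rewrite muln0; split=> //; exact: orbit_le0.
by move/(mono_filtration true); rewrite /mono lmono0 expr0 mulr1 rmorph1.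
Qed.

Lemma filtration_mull v N N' :
  (forall u b j, weight_le c N u j -> F N' (v * mono u b j)) ->
  forall w, F N w -> F N' (v * w).
Proof.
move=> H _ [d ->]; rewrite mulr_sumr; apply: in_span_sum => i _.
rewrite -scalerAr; apply: in_spanZ.
have /filtration_gensP[u [b [j [Hw ->]]]] := mem_nth 0 (ltn_ord i).
exact: H.
Qed.

Lemma filtration_is_mono N f u b j : is_mono z f u -> weight_le c N u j ->
  F N (iota f * xory b ^+ j).
Proof.
move=> [d d0 ->] Hw; rewrite linearZ -scalerAl; apply: in_spanZ.
exact: mono_filtration.
Qed.

Lemma filtration_iota us d C N1 N f u b j :
  (forall v, v \in us -> orbit_le M v C) ->
  in_span [seq lmono z v | v <- us] d ->
  is_mono z f u -> orbit_le M u N1 -> (N1 + c * j + C <= N)%N ->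
  F N (iota (f * d) * xory b ^+ j).
Proof.
move=> Hus [e ->] fu Hu le; rewrite mulr_sumr linear_sum mulr_suml.
apply: in_span_sum => i _; rewrite -scalerAr linearZ -scalerAl; apply: in_spanZ.
have /mapP[v vus ->] := mem_nth 0 (ltn_ord i).
apply: (filtration_is_mono _ (is_monoM HL fu (is_mono_lmono z v))).
by exists (N1 + C)%N; split; [exact: orbit_leD (Hus _ vus)|rewrite addnAC].
Qed.

Lemma filtration_iota_mul d : exists C, forall N w, F N w -> F (N + C) (iota d * w).
Proof.
have [us Hd] := lmono_span HL d.
have [C HC] := power_bounded_orbit_le_seq us (finite_order_power_bounded finM).
exists C => N; apply: filtration_mull => u b j [N1 [Hu le]].
rewrite /mono mulrA -rmorphM mulrC.
apply: (filtration_iota _ HC Hd (is_mono_lmono z u) Hu).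
by rewrite leq_add2r.
Qed.

(** Passing [x] or [y] across [z^u] applies a nonnegative power of [M] to [u] and keeps its orbit
    bound. A letter of the same kind then costs [c]; one of the opposite kind cancels, leaving
    [sigma a] or [a], whose exponents have orbit size at most [c]. *)
Lemma xory_filtration b : 
  (exists us, (forall v, v \in us -> orbit_le M v c) /\
     in_span [seq lmono z v | v <- us] (if b then sigma a else a)) ->
  forall N w, F N w -> F (N + c) (xory b * w).
Proof.
case=> us [Hus Ha] N.
have [[xd [yd [yx xy]]] _] := HA.
have [m [m0 Mm]] := finM.
pose s : L -> L := if b then sigma else sigmainv.
have xs d : xory b * iota d = iota (s d) * xory b by rewrite /s /xory; case: (b).
have s_mono u : exists i, is_mono z (s (lmono z u)) (M ^+ i *m u).
  rewrite /s; case: (b).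
    by exists 1%N; rewrite expr1; exact: (sigma_mono HL Halpha HM).
  by exists m.-1; exact: (sigmainv_mono HL Hs1 Halpha HM).
have xy' : xory b * xory (~~ b) = iota (if b then sigma a else a).
  by rewrite /xory; case: (b).
apply: filtration_mull => u b' j [N1 [Hu le]].
have [i Hi] := s_mono u; have {}Hu := orbit_leX i Hu.
rewrite /mono mulrA xs -mulrA.
have same l : (N1 + c * l <= N)%N ->
    F (N + c) (iota (s (lmono z u)) * (xory b * xory b ^+ l)).
  move=> le'; rewrite -exprS; apply: filtration_is_mono Hi _.
  by exists N1; split=> //; rewrite mulnS addnCA addnC leq_add2r.
case: (eqVneq b' b) => [-> | ne]; first exact: same.
have -> : b' = ~~ b by case: (b) (b') ne => [] [].
(* For [j = 0] nothing cancels, and the empty power counts as one of the same letter. *)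
case: j le => [|j] le; first by rewrite expr0 -(expr0 (xory b)); exact: same.
rewrite exprS [xory b * _]mulrA xy' mulrA -rmorphM.
apply: (filtration_iota _ Hus Ha Hi Hu).
by move: le; rewrite mulnS; lia.
Qed.

End Filtration.

Lemma gwa_growth_le (s : seq A) : exists C, forall m, (0 < m)%N ->
  (dim_span (words_upto s m) <= C * m ^ n.+1)%N.
Proof.
have [us1 Ha1] := lmono_span HL a; have [us2 Ha2] := lmono_span HL (sigma a).
have [c' Hc'] := power_bounded_orbit_le_seq (us1 ++ us2) (finite_order_power_bounded finM).
pose c := c'.+1.
have Hc u : u \in us1 ++ us2 -> orbit_le M u c.
  by move/Hc'; apply: orbit_le_mono.
have c0 : (0 < c)%N by [].
(* Elements of finite degree contain the generators and are closed under linear combinations and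
   products, so they exhaust [A]. *)
have bounded v : exists C, forall N w, in_span (filtration_gens c N) w ->
    in_span (filtration_gens c (N + C)) (v * w).
  move: v; apply: (gwa_ind HA).
  - by exists 0%N => N w; rewrite addn0 mul1r.
  - move=> d u v [C1 H1] [C2 H2]; exists (maxn C1 C2) => N w Hw.
    rewrite mulrDl -scalerAl; apply: in_spanD.
      apply/in_spanZ/(filtration_mono c0 _ (H1 _ _ Hw)).
      by rewrite leq_add2l leq_maxl.
    apply: (filtration_mono c0 _ (H2 _ _ Hw)).
    by rewrite leq_add2l leq_maxr.
  - move=> u v [C1 H1] [C2 H2]; exists (C2 + C1)%N => N w Hw.
    by rewrite -mulrA addnA; apply/H1/H2.
  - exact: filtration_iota_mul.
  - exists c; apply: (@xory_filtration c c0 true); exists us2; split=> // u Hu.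
    by apply: Hc; rewrite mem_cat Hu orbT.
  - exists c; apply: (@xory_filtration c c0 false); exists us1; split=> // u Hu.
    by apply: Hc; rewrite mem_cat Hu.
have [C HC] : exists C, forall v, v \in s -> forall N w,
    in_span (filtration_gens c N) w -> in_span (filtration_gens c (N + C)) (v * w).
  elim: s => [|v s [C1 IH]]; first by exists 0%N.
  have [C2 H2] := bounded v; exists (maxn C1 C2) => u.
  rewrite inE => /orP[/eqP -> | us] N w Hw.
    by apply: (filtration_mono c0 _ (H2 _ _ Hw)); rewrite leq_add2l leq_maxr.
  by apply: (filtration_mono c0 _ (IH _ us _ _ Hw)); rewrite leq_add2l leq_maxl.
(* Words of length at most [m] lie in level [C m], spanned by at most [(2 C m + 2)^(n+1)] elements;
   [m >= 1] absorbs the 2. *)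
exists ((2 * C + 2) ^ n.+1)%N => m m0.
apply: (@leq_trans (size (filtration_gens c (C * m)))).
  apply: dim_span_le => _ /words_uptoP[l [ls lm ->]].
  apply: (@filtration_mono c c0 (C * size l)); first by rewrite leq_mul2l lm orbT.
  elim: l ls {lm} => [|v l IH] ls; first by rewrite big_nil muln0; exact: filtration1.
  rewrite big_cons /= mulnS addnC; apply: HC; first by apply: ls; exact: mem_head.
  by apply: IH => u ul; apply: ls; rewrite inE ul orbT.
apply: leq_trans (size_filtration_gens _ _) _.
rewrite -expnMn leq_exp2r //.
by nia.
Qed.

End UpperBound.

(** * From growth estimates to the Gelfand-Kirillov dimension *)

Lemma GKdim_ge (K : fieldType) (B : algType K) (s : seq B) (C k p q : nat) :
  (0 < k)%N -> (0 < q)%N ->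
  (forall N, exists m, (N <= m)%N /\
     (m ^ p <= C * dim_span (words_upto s (k * m)) ^ q)%N) ->
  ((p%:R / q%:R)%:E <= GKdim B)%E.
Proof.
move=> k0 q0 H; apply: le_ereal_sup_tmp; eexists; first by exists s.
exact: (limn_esup_log_growth_ge _ (d := fun m => dim_span (words_upto s m)) k0 q0 H).
Qed.

Lemma GKdim_le (K : fieldType) (B : algType K) (p : nat) :
  (forall s : seq B, exists C, forall m, (0 < m)%N ->
     (dim_span (words_upto s m) <= C * m ^ p)%N) ->
  (GKdim B <= p%:R%:E)%E.
Proof.
move=> H; apply: ge_ereal_sup => _ [s _ <-].
have [C HC] := H s.
exact: (limn_esup_log_growth_le _ (d := fun m => dim_span (words_upto s m)) HC).
Qed.

Section GKdimGWA.
Variables (K : fieldType) (n : nat) (L : comUnitAlgType K) (z : 'I_n -> L).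
Hypothesis HL : is_laurent_alg z.
Variables (sigma sigmainv : {lrmorphism L -> L}).
Hypotheses (Hs1 : cancel sigma sigmainv) (Hs2 : cancel sigmainv sigma).
Variables (alpha : 'I_n -> K) (M : 'M[int]_n).
Hypotheses (Halpha : forall i, alpha i != 0)
  (HM : forall i, sigma (z i) = alpha i *: lmono z (col i M)).
Variables (a : L) (A : algType K) (iota : {lrmorphism L -> A}) (x y : A).
Hypothesis HA : is_gwa sigma sigmainv a iota x y.

Lemma GKdim_gwa_ge : (n.+1%:R%:E <= GKdim A)%E.
Proof.
rewrite -[n.+1%:R]divr1.
apply: (@GKdim_ge _ _ (gwa_gens z iota x) 1 (n + 4) n.+1 1) => //; first by rewrite addnS.
move=> N; exists N.+1; split; first exact: leqnSn.
(* With [g = 1] and [w = 0] there is a single box, which gives growth of order [m^(n+1)] for every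
   [M]. *)
have := @gwa_growth_ge _ _ _ _ HL _ _ Hs1 Hs2 _ _ Halpha HM _ _ _ _ _ HA N.+1 1 0 0.
rewrite !mul1n expn1; apply=> //; last by left.
by rewrite /l1norm big1 // => p _; rewrite mxE.
Qed.

(* If M has infinite order, some g <= |(M^i)_pq| with i <= m ~ (2g)^(n^2), so
   the dimension at m exceeds m^(n+1) by a factor g ~ m^(1/n^2). *)
Lemma GKdim_gwa_gt : ~ finite_order M -> (n.+1%:R%:E < GKdim A)%E.
Proof.
move=> noM; have injM := exponent_matrix_inj HL Hs1 Halpha HM.
have n0 : (0 < n)%N.
  by have [_ [p _]] := exprmx_large_entry injM 1 noM; apply: leq_ltn_trans (ltn_ord p).
set q := (n * n)%N; have q0 : (0 < q)%N by rewrite muln_gt0 n0.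
(* The exponent [n + 1 + 1/q] with [q = n^2]. *)
apply: (@lt_le_trans _ _ ((n.+1 * q + 1)%:R / q%:R)%:E).
  by rewrite lte_fin ltr_pdivlMr ?ltr0n // -natrM ltr_nat addn1.
apply: (@GKdim_ge _ _ (gwa_gens z iota x) (2 ^ q.+1) (n + 4)) => //; first by rewrite addnS.
move=> N; pose g := N.+1; pose m := ((2 * g) ^ q).+1.
have gm : (g <= (2 * g) ^ q)%N.
  apply: (@leq_trans (2 * g)); first by rewrite leq_pmull.
  by rewrite -[X in (X <= _)%N]expn1 leq_pexp2l.
exists m; split; first by apply: leq_trans (leqnSn _); apply: leq_trans (leqnSn _) gm.
have [i [p [r [_ im gle]]]] := exprmx_large_entry injM g noM.
have growth : (g * m ^ n.+1 <= dim_span (words_upto (gwa_gens z iota x) ((n + 4) * m)))%N.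
  apply: (gwa_growth_ge HL Hs1 Hs2 Halpha HM HA (i := i) (w := delta_mx r 0)) => //.
  - exact: leq_trans gm (leqnSn _).
  - rewrite /l1norm (bigD1 r) //= mxE !eqxx big1 // => l /negbTE nl.
    by rewrite mxE nl.
  - by right; exists p; rewrite -colE mxE.
(* One factor [m = (2g)^q + 1] is absorbed by [2^(q+1) g^q = 2 (2g)^q]. *)
apply: (@leq_trans (2 ^ q.+1 * (g * m ^ n.+1) ^ q)); last first.
  by rewrite leq_mul2l leq_exp2r // growth orbT.
rewrite expnD expn1 expnMn -expnM mulnA mulnC leq_mul //.
rewrite expnS -mulnA -expnMn mul2n -addnn -[X in (X <= _)%N]addn1 leq_add2l expn_gt0.
by rewrite muln_gt0.
Qed.

Lemma GKdim_gwa_le : finite_order M -> (GKdim A <= n.+1%:R%:E)%E.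
Proof.
by move=> finM; apply: GKdim_le => s; exact: (gwa_growth_le HL Hs1 Halpha HM HA finM).
Qed.

End GKdimGWA.

Theorem theorem0p3 (k : fieldType) (n : nat)
  (L : comUnitAlgType k) (z : 'I_n -> L) (HL : is_laurent_alg z)
  (sigma sigmainv : {lrmorphism L -> L})
  (Hs1 : cancel sigma sigmainv) (Hs2 : cancel sigmainv sigma)
  (alpha : 'I_n -> k) (M : 'M[int]_n)
  (Halpha : forall i, alpha i != 0)
  (HM : forall i, sigma (z i) = alpha i *: lmono z (col i M))
  (a : L)
  (A : algType k) (iota : {lrmorphism L -> A}) (x y : A)
  (HA : is_gwa sigma sigmainv a iota x y) :
  [/\ (GKdim A = (n.+1)%:R%:E <-> locally_algebraic sigma),
      (locally_algebraic sigma <-> exists m : nat, (0 < m)%N /\ M ^+ m = 1%:M) &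
      ((exists m : nat, (0 < m)%N /\ M ^+ m = 1%:M) <->
       exists N : int, 0 < N /\
         forall m : nat, (0 < m)%N -> forall i j, `|(M ^+ m) i j| < N)].
Proof.
have fin_pb : finite_order M <-> power_bounded M.
  split; first exact: finite_order_power_bounded.
  exact/power_bounded_finite_order/(exponent_matrix_inj HL Hs1 Halpha HM).
have la_fin : locally_algebraic sigma <-> finite_order M.
  split; last exact: (finite_order_locally_algebraic HL Hs1 Hs2 Halpha HM).
  by move/(locally_algebraic_power_bounded HL Halpha HM)/fin_pb.
split=> //; split=> [GK|/la_fin finM].
  apply/la_fin; apply: contrapT => noM.
  by have := GKdim_gwa_gt HL Hs1 Hs2 Halpha HM HA noM; rewrite GK ltxx.
apply/eqP; rewrite eq_le (GKdim_gwa_le HL Hs1 Halpha HM HA finM).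
exact: (GKdim_gwa_ge HL Hs1 Hs2 Halpha HM HA).
Qed.
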